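(* There is an absolute constant $C>0$ such that for every alphabet $\Sigma$ of size $\sigma\ge 2$, every positive integer $d$, and every string $T$ over $\Sigma$ of length $n>d$, $\mathcal{S}(T,d)\le C\min\{d,\sigma\}\,n$, i.e., $\mathcal{S}(T,d)\in O(\min\{d,\sigma\}n)$. This upper bound is tight when $n-d\in\Omega(n)$: for every constant $\gamma\in(0,1)$ there is a constant $c>0$ such that for all $\sigma\ge 2$ and all $d<n$ with $n-d\ge\gamma n$ there exists a string $T$ of length $n$ over an alphabet of size $\sigma$ with $\mathcal{S}(T,d)\ge c\min\{d,\sigma\}\,n$.
   Context: For a string $S$ over alphabet $\Sigma$, a string $w\in\Sigma^*$ is a minimal absent word (MAW) of $S$ if $w$ does not occur in $S$ but every proper substring of $w$ (including the empty string) occurs in $S$; $\mathsf{MAW}(S)$ is the set of all MAWs of $S$. $T[a..b]$ denotes the substring of $T$ from position $a$ to $b$. For a string $T$ of length $n>d$, $\mathcal{S}(T,d)=\sum_{i=1}^{n-d}|\mathsf{MAW}(T[i..i+d-1])\bigtriangleup\mathsf{MAW}(T[i+1..i+d])|$, where $\bigtriangleup$ is symmetric difference. *)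

(* Defs.v *)
From mathcomp Require Import all_boot all_order all_algebra.
From mathcomp Require Import reals.
Set Implicit Arguments. Unset Strict Implicit. Unset Printing Implicit Defensive.

Section MAW.
Variable A : finType.

Definition substrings (w : seq A) : seq (seq A) :=
  [seq take j (drop i w) | i <- iota 0 (size w).+1, j <- iota 0 (size w).+1].

Definition is_maw (S w : seq A) : bool :=
  ~~ infix w S && all (fun u => (u == w) || infix u S) (substrings w).

Fixpoint words (k : nat) : seq (seq A) :=
  if k is k'.+1 then [seq a :: w | a <- enum A, w <- words k'] else [:: [::]].

(* MAW(S), as a list.  Every MAW w of S satisfies size w <= size S + 1
   (lemma maw_size below), so enumerating candidates up to that length
   yields the whole set. *)
Definition MAW (S : seq A) : seq (seq A) :=
  [seq w <- flatten [seq words k | k <- iota 0 (size S).+2] | is_maw S w].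

Definition maw_symdiff (S1 S2 : seq A) : nat :=
  size [seq w <- MAW S1 | w \notin MAW S2] + size [seq w <- MAW S2 | w \notin MAW S1].

(* S(T,d) = sum_{i=1}^{n-d} |MAW(T[i..i+d-1]) Δ MAW(T[i+1..i+d])|,
   written with 0-based i: T[i+1..i+d] = take d (drop i T). *)
Definition Ssum (T : seq A) (d : nat) : nat :=
  \sum_(0 <= i < size T - d) maw_symdiff (take d (drop i T)) (take d (drop i.+1 T)).

Lemma maw_size (S w : seq A) : is_maw S w -> size w <= (size S).+1.
Proof.
case/andP => nw /allP H.
case: (lastP w) nw H => [|u a] nw H.
  by rewrite infix0s in nw.
have : take (size u) (drop 0 (rcons u a)) \in substrings (rcons u a).
  apply/allpairsP; exists (0%N, size u) => /=.
  have E k : k \in 0 :: iota 1 (size (rcons u a)) = (k < (size u).+2)%N.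
    by rewrite -[0 :: _]/(iota 0 (size (rcons u a)).+1) mem_iota size_rcons.
  by rewrite !E ltnS leqW.
move/H; rewrite drop0 -cats1 take_size_cat // => /orP [].
  by move/eqP/(congr1 size); rewrite size_cat addn1 => /n_Sn.
by move/size_infix; rewrite size_cat addn1.
Qed.

End MAW.

(* Main.v *)
Require Import Defs.
From mathcomp Require Import all_boot all_order all_algebra.
From mathcomp Require Import reals zify.
(** Upper bound: go from one window [S] to the next by appending a letter [z]
    and then deleting the first letter; reversal exchanges the two kinds of
    steps.  Appending [z] destroys at most one MAW.  Let [l] and [l'] be the
    lengths of the longest repeated suffixes of [S] and [S z].  A new MAW either
    extends by one letter the shortest suffix of [S z] absent from [S], or is a
    letter followed by a suffix of [S z] of length [k + 1] with [l' <= k <= l].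
    Since [l] increases by at most 1 per step, the sum of all [l - l' + 1] is at
    most [n], and each suffix is extended by at most [min (d + 1, #|A|)] letters.

    Lower bound: if [min (d, #|A|)] is bounded, the alternating word works, as
    distinct words of equal length have distinct sets of MAWs.  Otherwise take
    the periodic word [c_0 a^(B-1) c_1 a^(B-1) ... c_(s-1) a^(B-1)] with
    [s = min (d, #|A| - 1)] and [s B] slightly larger than [d]: a window ending
    with [c_P a^r] contains [c_P] only once, so every [c_P a^r c_Q] with
    [a^r c_Q] in the window is a MAW that the previous window did not have. *)

Set Implicit Arguments. Unset Strict Implicit. Unset Printing Implicit Defensive.

(* Unfolds the [eqType] coercions in the type argument of [size], which hide
   equal terms from [lia]. *)
Local Ltac slia := simpl in *; lia.

Section MinimalAbsentWords.
Variable A : finType.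
Implicit Types (S T u v w x : seq A) (a b z : A).

(** * Characterizations of minimal absent words *)

Lemma mem_substrings u w : (u \in substrings w) = infix u w.
Proof.
apply/allpairsP/infixP => [[[i j] /= [_ _ ->]]|[p [s ->]]].
  by exists (take i w), (drop j (drop i w)); rewrite !cat_take_drop.
exists (size p, size u); rewrite !mem_iota !size_cat /= !add0n.
by split; [lia|lia|rewrite drop_size_cat // take_size_cat].
Qed.

Lemma is_mawP S w :
  reflect (~~ infix w S /\ forall u, infix u w -> u != w -> infix u S)
          (is_maw S w).
Proof.
apply: (iffP andP) => -[nw H]; split => //.
  move=> u uw nuw; move/allP/(_ u): H.
  by rewrite mem_substrings => /(_ uw); rewrite (negbTE nuw).
apply/allP => u; rewrite mem_substrings => uw.
by case: (eqVneq u w) => //= nuw; apply: H.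
Qed.

Lemma is_maw_nil S : is_maw S [::] = false.
Proof. by rewrite /is_maw infix0s. Qed.

Lemma is_maw_seq1 S a : is_maw S [:: a] = (a \notin S).
Proof.
apply/is_mawP/idP => [[]|aS]; rewrite infix1s //.
by split=> // u; rewrite infixs1 => /orP[]/eqP-> //; rewrite ?infix0s ?eqxx.
Qed.

Lemma infix_cons_rcons v a u b : infix v (a :: rcons u b) ->
  [\/ v = a :: rcons u b, infix v (a :: u) | infix v (rcons u b)].
Proof.
rewrite infix_consl => /orP[|vub]; last by constructor 3.
case/prefixP => s; case/lastP: s => [|s c]; first by rewrite cats0; constructor 1.
rewrite -rcons_cons -rcons_cat => /rcons_inj[-> _]; constructor 2; exact: prefix_infix.
Qed.

(** Every proper factor of [a u b] misses its first or its last letter, so it lies in [a u] or in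
    [u b]. *)
Lemma is_maw_cons_rcons S a u b :
  is_maw S (a :: rcons u b) =
  [&& ~~ infix (a :: rcons u b) S, infix (a :: u) S & infix (rcons u b) S].
Proof.
apply/is_mawP/and3P => [[nw H]|[nw auS ubS]]; split => //.
- apply: H; first by rewrite -rcons_cons infix_rcons.
  by apply/eqP => /(congr1 size); rewrite /= size_rcons; lia.
- apply: H; first exact: infix_cons.
  by apply/eqP => /(congr1 size); rewrite /= size_rcons; lia.
move=> v /infix_cons_rcons[->|/infix_trans|/infix_trans]; rewrite ?eqxx //.
  by move=> + _; apply.
by move=> + _; apply.
Qed.

Lemma mem_words k w : (w \in words A k) = (size w == k).
Proof.
elim: k w => [|k IH] [|a w] //=; first by apply/allpairsP => -[[b v] /= []].
rewrite eqSS -IH; apply/allpairsP/idP => [[[b v] /= [_ vk [_ ->]]] //|wk].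
by exists (a, w); rewrite /= mem_enum.
Qed.

Lemma words_uniq k : uniq (words A k).
Proof.
elim: k => //= k IH; apply: allpairs_uniq => //; first exact: enum_uniq.
by move=> [a u] [b v] _ _ /= [-> ->].
Qed.

Lemma mem_MAW S w : (w \in MAW S) = is_maw S w.
Proof.
rewrite mem_filter; case: (boolP (is_maw S w)) => // mw; rewrite andTb.
apply/flatten_mapP; exists (size w); last by rewrite mem_words.
by rewrite mem_iota add0n ltnS (maw_size mw).
Qed.

Lemma MAW_uniq S : uniq (MAW S).
Proof.
apply: filter_uniq; have := iota_uniq 0 (size S).+2.
elim: (iota _ _) => //= k ks IH /andP[kks uks].
rewrite cat_uniq words_uniq IH // andbT -all_predC; apply/allP => w /flatten_mapP[j jks].
rewrite /= !mem_words => /eqP ->; apply: contra kks => /eqP <- //.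
Qed.

(** * Symmetric differences of sets of MAWs: triangle inequality, reversal, positivity *)

Definition maw_diff S1 S2 := [seq w <- MAW S1 | w \notin MAW S2].

Lemma mem_maw_diff S1 S2 w :
  (w \in maw_diff S1 S2) = is_maw S1 w && ~~ is_maw S2 w.
Proof. by rewrite mem_filter !mem_MAW andbC. Qed.

Lemma maw_diff_uniq S1 S2 : uniq (maw_diff S1 S2).
Proof. exact/filter_uniq/MAW_uniq. Qed.

Lemma maw_symdiffE S1 S2 :
  maw_symdiff S1 S2 = size (maw_diff S1 S2) + size (maw_diff S2 S1).
Proof. by []. Qed.

Lemma maw_symdiffC S1 S2 : maw_symdiff S1 S2 = maw_symdiff S2 S1.
Proof. by rewrite !maw_symdiffE addnC. Qed.

Lemma maw_diff_triangle S1 S2 S3 :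
  size (maw_diff S1 S3) <= size (maw_diff S1 S2) + size (maw_diff S2 S3).
Proof.
rewrite -size_cat; apply: uniq_leq_size (maw_diff_uniq _ _) _ => w.
by rewrite mem_cat !mem_maw_diff; case: (is_maw S1 w); case: (is_maw S2 w); case: (is_maw S3 w).
Qed.

Lemma maw_symdiff_triangle S1 S2 S3 :
  maw_symdiff S1 S3 <= maw_symdiff S1 S2 + maw_symdiff S2 S3.
Proof.
rewrite !maw_symdiffE.
have := maw_diff_triangle S1 S2 S3; have := maw_diff_triangle S3 S2 S1; lia.
Qed.

Lemma is_maw_rev S w : is_maw (rev S) (rev w) = is_maw S w.
Proof.
apply/is_mawP/is_mawP; rewrite infix_rev => -[nw H]; split => // u uw nuw.
  by rewrite -infix_rev H ?infix_rev // (can_eq revK).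
by rewrite -infix_revLR H ?infix_revLR // -(can_eq revK) revK.
Qed.

Lemma maw_diff_rev S1 S2 :
  size (maw_diff (rev S1) (rev S2)) <= size (maw_diff S1 S2).
Proof.
rewrite -(size_map rev); apply: uniq_leq_size.
  by rewrite (map_inj_uniq (can_inj revK)) maw_diff_uniq.
move=> _ /mapP[w + ->]; rewrite !mem_maw_diff.
by rewrite -[in X in X -> _](revK w) !is_maw_rev.
Qed.

Lemma maw_symdiff_rev S1 S2 :
  maw_symdiff (rev S1) (rev S2) = maw_symdiff S1 S2.
Proof.
rewrite !maw_symdiffE; have le := maw_diff_rev.
have := le (rev S1) (rev S2); have := le (rev S2) (rev S1).
by rewrite !revK; have := le S1 S2; have := le S2 S1; lia.
Qed.

(** Induction on the length: an absent word that is not a MAW has a strictly shorter absent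
    factor. *)
Lemma absent_has_maw S w : ~~ infix w S -> exists2 u, infix u w & is_maw S u.
Proof.
have [n] := ubnP (size w); elim: n w => // n IH w szw nw.
case: (boolP (is_maw S w)) => [mw|]; first by exists w; rewrite ?infix_refl.
case/nandP; first by rewrite negbK (negbTE nw).
case/allPn => u; rewrite mem_substrings negb_or => uw /andP[nuw nuS].
have [|//|v vu mv] := IH u; last by exists v => //; apply: infix_trans uw.
case/infixP: uw nuw szw => p [s ->]; rewrite !size_cat => + szw.
case: (posnP (size p + size s)) => [|lt0 _].
  by move/eqP; rewrite addn_eq0 !size_eq0 => /andP[/eqP-> /eqP->]; rewrite cats0 eqxx.
rewrite addnCA ltnS in szw; apply: leq_trans szw.
by rewrite -[X in X < _]addn0 ltn_add2l.
Qed.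

(* A shortest factor of [S1] that is absent from [S2] is a MAW of [S2] only. *)
Lemma maw_symdiff_gt0 S1 S2 :
  size S1 = size S2 -> S1 != S2 -> 0 < maw_symdiff S1 S2.
Proof.
move=> sz ne; have /absent_has_maw[u uS1 mu] : ~~ infix S1 S2.
  apply: contra ne => /infixP[p [s E]].
  move: sz; rewrite E !size_cat addnCA -[LHS]addn0 => /addnI/esym/eqP.
  rewrite addn_eq0 !size_eq0 => /andP[/eqP-> /eqP->].
  by rewrite cats0.
rewrite maw_symdiffE addn_gt0; apply/orP; right.
suff: u \in maw_diff S2 S1 by case: (maw_diff _ _).
by rewrite mem_maw_diff mu; apply/is_mawP => -[]; rewrite uS1.
Qed.

(** * Repeated suffixes *)

(* The length of the longest suffix of [S] that occurs at least twice in [S]. *)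
Definition lrs S : nat :=
  \max_(k < (size S).+1 | infix (drop (size S - k) S) (take (size S).-1 S)) k.

Lemma suffix_dropE u S : suffix u S -> u = drop (size S - size u) S.
Proof. by rewrite suffixE => /eqP. Qed.

Lemma suffix_leq u v S : suffix u S -> suffix v S -> size u <= size v -> suffix u v.
Proof.
move=> uS vS le; rewrite (suffix_dropE uS) (suffix_dropE vS).
have leS := size_suffix vS; rewrite /= in leS.
have -> : size S - size u = size v - size u + (size S - size v) by lia.
by rewrite -drop_drop suffix_drop.
Qed.

(** A suffix of a repeated suffix is itself repeated, so comparing lengths decides repetition. *)
Lemma suffix_infix_lrs u S :
  suffix u S -> infix u (take (size S).-1 S) = (size u <= lrs S).
Proof.
move=> uS; apply/idP/idP => [uin|].
  rewrite /lrs; have lt : size u < (size S).+1 by rewrite ltnS size_suffix.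
  apply: (@leq_bigmax_cond _ _ (fun k : 'I__ => k : nat) (Ordinal lt)).
  by rewrite /= -suffix_dropE.
have: 0 < #|[pred k : 'I_(size S).+1 | infix (drop (size S - k) S) (take (size S).-1 S)]|.
  by apply/card_gt0P; exists ord0; rewrite inE subn0 drop_size infix0s.
rewrite /lrs; case/(eq_bigmax_cond (fun k : 'I__ => k : nat)) => k kin -> le.
apply: infix_trans kin; apply/suffixW/(suffix_leq uS); first exact: suffix_drop.
by rewrite size_drop; have := ltn_ord k; slia.
Qed.

Lemma suffix_infix_lrs_rcons u S z :
  suffix u (rcons S z) -> infix u S = (size u <= lrs (rcons S z)).
Proof.
by move/suffix_infix_lrs <-; rewrite size_rcons -cats1 take_size_cat.
Qed.

Lemma leq_lrs S : lrs S <= size S.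
Proof. by apply/bigmax_leqP => k _; rewrite -ltnS. Qed.

Lemma infix_rcons_belast u S a : infix (rcons u a) S -> infix u (take (size S).-1 S).
Proof.
case/lastP: S => [|S b]; first by rewrite infixs0 -size_eq0 size_rcons.
rewrite size_rcons -(cats1 S) take_size_cat // cats1 infix_rconsl suffix_rcons.
case/orP => [/andP[_ /suffixW //]|]; apply: infix_trans; exact: infix_rcons.
Qed.

(** Removing the final [z] from a repeated suffix of [rcons S z] leaves a repeated suffix of [S]. *)
Lemma lrs_rcons S z : lrs (rcons S z) <= (lrs S).+1.
Proof.
case E: (lrs (rcons S z)) => [//|k].
have leS := leq_lrs (rcons S z); rewrite size_rcons E ltnS in leS.
have := suffix_infix_lrs_rcons (suffix_drop (rcons S z) (size S - k)).
rewrite E size_drop size_rcons drop_rcons; last by slia.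
set u := drop _ S; have szu : size u = k by rewrite size_drop; slia.
have -> : (size S).+1 - (size S - k) <= k.+1 by slia.
have su : suffix u S by exact: suffix_drop.
move=> uzS; rewrite -szu ltnS -suffix_infix_lrs //.
exact: infix_rcons_belast uzS.
Qed.

Lemma lrs_suffix S S' : suffix S' S -> lrs S' <= lrs S.
Proof.
move=> sS; have leS' := leq_lrs S'; have leS := size_suffix sS.
set u := drop (size S' - lrs S') S'.
have szu : size u = lrs S' by rewrite size_drop; slia.
have su' : suffix u S' by exact: suffix_drop.
have su : suffix u S by apply: suffix_trans sS.
rewrite -[X in X <= _]szu -suffix_infix_lrs //.
have : infix u (take (size S').-1 S') by rewrite suffix_infix_lrs // szu.
move/infix_trans; apply.
case/suffixP: sS => p ->; case: (posnP (size S')) => [/size0nil->|lt0]; first by rewrite infix0s.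
rewrite take_cat size_cat; case: ltnP => [|_]; first by slia.
have -> : (size p + size S').-1 - size p = (size S').-1 by slia.
exact: suffix_infix.
Qed.

(** * Appending one letter *)

Lemma size_undup_rcons S z : size (undup (rcons S z)) <= minn (size S).+1 #|A|.
Proof.
by rewrite leq_min -(size_rcons S z) size_undup -(card_uniqP (undup_uniq _)) max_card.
Qed.

(* [x] is the shortest suffix of [rcons S z] absent from [S]: it is the only
   MAW that can disappear.  A new MAW [a u b] has [a u] or [u b] absent from
   [S]: in the former case [a u = x], in the latter [u] is a suffix of [S]
   occurring twice in [S]. *)
Lemma maw_append_cases S z w (x := drop (size S - lrs (rcons S z)) (rcons S z)) :
  is_maw S w != is_maw (rcons S z) w ->
  [\/ w = x,
      exists2 b, b \in rcons S z & w = rcons x b |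
      exists2 a, a \in rcons S z & exists2 k, lrs (rcons S z) <= k <= lrs S &
        w = a :: drop (size S - k) (rcons S z)].
Proof.
have szSz := size_rcons S z; have infSz := infix_rcons S z.
have lel : lrs (rcons S z) <= size S.
  have := suffix_infix_lrs_rcons (suffix_refl (rcons S z)); rewrite szSz.
  by case: (boolP (infix _ _)) => [/size_infix|_ /esym] H; slia.
have lrsE u : suffix u (rcons S z) -> infix u S = (size u <= lrs (rcons S z)).
  exact: suffix_infix_lrs_rcons.
have xE a u : suffix (a :: u) (rcons S z) -> ~~ infix (a :: u) S -> infix u S -> a :: u = x.
  move=> sau; rewrite lrsE // lrsE; last exact: suffix_trans (suffix_cons u a) sau.
  have := size_suffix sau.
  by move=> ? ? ?; rewrite [LHS](suffix_dropE sau) szSz; congr drop; slia.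
have sufE u : infix u (rcons S z) -> ~~ infix u S -> suffix u (rcons S z).
  by rewrite infix_rconsl => /orP[//|->].
case: w => [|a w]; first by rewrite !is_maw_nil.
case/lastP: w => [|u b].
  rewrite !is_maw_seq1 => ne; constructor 1; have naS : a \notin S.
    by apply: contra_neqN ne => aS; rewrite mem_rcons inE aS orbT.
  apply: xE; rewrite ?infix0s ?infix1s // sufE ?infix1s //.
  by move: ne; rewrite naS; case: (a \in _).
rewrite !is_maw_cons_rcons.
(* If [a u] is new, it is a suffix of [rcons S z], while [u] already occurs in [S]; this forces
   [a u = x]. *)
case: (boolP (infix (a :: u) S)) => auS; last first.
  rewrite andbF /= => /negPn ne0; constructor 2.
  have {ne0}/and3P[nw auSz ubSz] := ne0.
  exists b; first by apply: (mem_infix ubSz); rewrite mem_rcons mem_head.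
  rewrite -rcons_cons -(@xE a u) //; first exact: sufE.
  have : infix (rcons u b) S || suffix (rcons u b) (rcons S z).
    by move: ubSz; rewrite infix_rconsl orbC.
  case/orP => [|]; last by rewrite suffix_rcons => /andP[_ /suffixW].
  by apply: infix_trans; apply: infix_rcons.
case: (boolP (infix (rcons u b) S)) => ubS; rewrite ?andbF ?andbT /=; last first.
  move=> /negPn/and3P[nw auSz ubSz]; constructor 3.
  exists a; first by apply: (mem_infix auSz); rewrite mem_head.
  have sub := sufE _ ubSz ubS; exists (size u); last first.
    by congr (_ :: _); rewrite [LHS](suffix_dropE sub) !size_rcons subSS.
  have := lrsE _ sub; rewrite (negbTE ubS) size_rcons => /esym lt.
  have su : suffix u S by move: sub; rewrite suffix_rcons => /andP[].
  rewrite -suffix_infix_lrs //; apply/andP; split; first by slia.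
  (* The occurrence of [a u] in [S] cannot end [S], since appending [z = b] would create [w]. A
     letter thus follows it, which gives an earlier occurrence of [u]. *)
  case/infixP: auS nw => p [s ->]; case: s => [|c s] nw.
    case/negP: nw; move: sub; rewrite suffix_rcons => /andP[/eqP-> _].
    by rewrite cats0 rcons_cat -rcons_cons suffix_infix.
  apply: (@infix_trans _ (a :: u)); first exact: infix_cons.
  by apply: (@infix_rcons_belast _ _ c); rewrite -cat_rcons infix_infix.
(* Both [a u] and [u b] occur in [S]: here [w] is the MAW destroyed by its first occurrence, at the
   end of [rcons S z]. *)
rewrite (infix_trans auS infSz) (infix_trans ubS infSz) !andbT => ne.
constructor 1; have nw : ~~ infix (a :: rcons u b) S.
  by apply: contra_neqN ne => wS; rewrite wS (infix_trans wS infSz).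
by apply: xE => //; apply: sufE => //; move: ne; rewrite nw; case: (infix _ _).
Qed.

Lemma maw_symdiff_append S z (mu := size (undup (rcons S z))) :
  maw_symdiff S (rcons S z) <= 1 + mu + mu * ((lrs S).+1 - lrs (rcons S z)).
Proof.
rewrite maw_symdiffE -size_cat.
set Sz := rcons S z; set x := drop (size S - lrs Sz) Sz.
(* The candidates are the three families of [maw_append_cases]; the last one has one length [k] for
   each value from [lrs Sz] to [lrs S]. *)
set L := x :: [seq rcons x b | b <- undup Sz] ++
  [seq a :: drop (size S - k) Sz | a <- undup Sz, k <- iota (lrs Sz) ((lrs S).+1 - lrs Sz)].
have -> : 1 + mu + mu * ((lrs S).+1 - lrs Sz) = size L.
  by rewrite /L /= size_cat size_map size_allpairs size_iota -addnA.
apply: uniq_leq_size => [|w].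
  rewrite cat_uniq !maw_diff_uniq andbT -all_predC; apply/allP => w /=.
  by rewrite !mem_maw_diff => /andP[-> /negbTE->].
rewrite mem_cat !mem_maw_diff => w_in.
have : is_maw S w != is_maw Sz w.
  by case/orP: w_in => /andP[-> /negbTE->].
case/maw_append_cases => [->|[b bin ->]|[a ain [k kin ->]]].
- exact: mem_head.
- rewrite inE mem_cat; apply/orP; right; apply/orP; left.
  by apply/mapP; exists b; rewrite ?mem_undup.
- rewrite inE mem_cat; apply/orP; right; apply/orP; right.
  apply/allpairsP; exists (a, k); rewrite mem_undup mem_iota; split => //=.
  by move: kin; rewrite -/Sz; lia.
Qed.

(** For nonempty [S], [mu] is at most twice the minimum, and the summand 1 is at most the minimum;
    hence the factors 3 and 2. *)
Lemma maw_symdiff_append_le S z : 0 < size S ->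
  maw_symdiff S (rcons S z) <=
    3 * minn (size S) #|A| + 2 * minn (size S) #|A| * ((lrs S).+1 - lrs (rcons S z)).
Proof.
move=> S0; apply: leq_trans (maw_symdiff_append S z) _.
have := size_undup_rcons S z; set mu := size _; set e := _ - _ => le.
have A0 : 0 < #|A| by apply/card_gt0P; exists z.
have le2 : mu <= 2 * minn (size S) #|A| by lia.
by apply: leq_add; [lia|rewrite leq_mul2r le2 orbT].
Qed.

(** * Sliding windows and the upper bound *)

Definition window T d i := take d (drop i T).

Lemma size_window T d i : i + d <= size T -> size (window T d i) = d.
Proof. by move=> le; rewrite size_takel // size_drop; lia. Qed.

Lemma windowS T d i (z : A) : i + d < size T ->
  window T d.+1 i = rcons (window T d i) (nth z T (i + d)).
Proof.
by move=> lt; rewrite /window -nth_drop -take_nth // size_drop; lia.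
Qed.

Lemma suffix_windowS T d i : suffix (window T d i.+1) (window T d.+1 i).
Proof.
by rewrite /window -[i.+1]add1n -drop_drop take_drop addn1 suffix_drop.
Qed.

Lemma rev_window T d i : i + d <= size T ->
  window (rev T) d i = rev (window T d (size T - d - i)).
Proof.
move=> le; rewrite /window drop_rev take_rev take_drop size_takel ?leq_subr //.
by congr (rev (drop _ (take _ _))); lia.
Qed.

(* The length of the longest repeated suffix grows by at most 1 per step, so
   its total decrease, which controls the third family of MAWs of
   [maw_append_cases], is at most the length of [T]. *)
Lemma sum_symdiff_append T d : 0 < d -> d < size T ->
  \sum_(0 <= i < size T - d) maw_symdiff (window T d i) (window T d.+1 i)
    <= 5 * minn d #|A| * size T.
Proof.
move=> d0 dT; set M := minn d _.
have z : A by case: T dT.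
set l := fun i => lrs (window T d i).
set l' := fun i => lrs (window T d.+1 i).
have tele m : m <= size T - d -> \sum_(0 <= i < m) ((l i).+1 - l' i) + l m <= l 0 + m.
  elim: m => [|m IH] le; first by rewrite big_nil add0n addn0.
  rewrite big_nat_recr //=; have := IH (ltnW le).
  have : l m.+1 <= l' m by apply/lrs_suffix/suffix_windowS.
  have : l' m <= (l m).+1 by rewrite /l' (windowS z) ?lrs_rcons //; lia.
  lia.
apply: (@leq_trans (\sum_(0 <= i < size T - d) (3 * M + 2 * M * ((l i).+1 - l' i)))).
  rewrite !big_mkord; apply: leq_sum => i _; have lt := ltn_ord i.
  have sz : size (window T d i) = d by apply: size_window; lia.
  rewrite /l' (windowS z); last by lia.
  have := @maw_symdiff_append_le (window T d i) (nth z T (i + d)).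
  by rewrite sz; exact.
rewrite big_split /= sum_nat_const_nat -big_distrr /=.
have := tele _ (leqnn _); have : l 0 <= d.
  by apply: leq_trans (leq_lrs _) _; rewrite size_window; lia.
set s := \sum_(_ <= _ < _) _ => ? ?.
have : s <= size T by lia.
by move=> ?; nia.
Qed.

(** In the reversed word, deleting a first letter becomes appending a letter read backwards, so the
    previous bound applies. *)
Lemma sum_symdiff_behead T d : 0 < d -> d < size T ->
  \sum_(0 <= i < size T - d) maw_symdiff (window T d.+1 i) (window T d i.+1)
    <= 5 * minn d #|A| * size T.
Proof.
move=> d0 dT; have := @sum_symdiff_append (rev T) d d0; rewrite size_rev => /(_ dT).
apply: leq_trans; rewrite big_nat_rev add0n big_nat [X in _ <= X]big_nat.
apply: leq_sum => i /andP[_ lt].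
rewrite !rev_window; [|lia|lia].
rewrite maw_symdiff_rev maw_symdiffC leq_eqVlt; apply/orP; left; apply/eqP.
by congr maw_symdiff; congr window; lia.
Qed.

(** The window of length [d.+1] is the intermediate word in the triangle inequality; each half
    contributes 5. *)
Lemma Ssum_upper T d : 0 < d -> d < size T ->
  Ssum T d <= 10 * minn d #|A| * size T.
Proof.
move=> d0 dT; have := leq_add (sum_symdiff_append d0 dT) (sum_symdiff_behead d0 dT).
rewrite -mulnDl -mulnDl; apply: leq_trans; rewrite -big_split /=.
by apply: leq_sum => i _; apply: maw_symdiff_triangle.
Qed.

End MinimalAbsentWords.

(** * Factors of words given by a function on positions *)

Section Factors.
Variables (A : finType) (f : nat -> A).

Lemma window_mkseq n d i : i + d <= n ->
  window (mkseq f n) d i = map f (iota i d).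
Proof.
move=> le; rewrite /window /mkseq -map_drop -map_take drop_iota take_iota.
by congr (map f (iota _ _)); lia.
Qed.

Lemma infix_map_iota p m i d : i <= p -> p + m <= i + d ->
  infix (map f (iota p m)) (map f (iota i d)).
Proof.
move=> ip le; have -> : d = (p - i) + (m + (d - m - (p - i))) by lia.
rewrite !iotaD !map_cat; have -> : i + (p - i) = p by lia.
exact: infix_infix.
Qed.

Lemma infix_map_iotaP u i d : infix u (map f (iota i d)) ->
  exists p, [/\ i <= p, p + size u <= i + d & u = map f (iota p (size u))].
Proof.
case/infixP => s [s' E]; exists (i + size s).
have := congr1 size E; rewrite size_map size_iota !size_cat /= => szE.
split; [lia|by simpl in *; lia|].
have -> : u = take (size u) (drop (size s) (map f (iota i d))).
  by rewrite E drop_size_cat // take_size_cat.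
rewrite -map_drop -map_take drop_iota take_iota size_map size_iota.
by congr (map f (iota _ _)); simpl in *; lia.
Qed.

Lemma Ssum_mkseq_ge n d m : d < n ->
  (forall i, i + d < n -> m <= maw_symdiff (map f (iota i d)) (map f (iota i.+1 d))) ->
  m * (n - d) <= Ssum (mkseq f n) d.
Proof.
move=> dn H; rewrite /Ssum size_mkseq.
rewrite -[n - d in X in X <= _]subn0 mulnC -sum_nat_const_nat.
rewrite big_nat [X in _ <= X]big_nat; apply: leq_sum => i /andP[_ lt].
by rewrite -!/(window _ _ _) !window_mkseq ?H; lia.
Qed.

End Factors.

(** * Words with large sums: the alternating word and the block word *)

Lemma Ssum_alternating (A : finType) (a b : A) n d : a != b -> 0 < d -> d < n ->
  n - d <= Ssum (mkseq (fun i => if odd i then a else b) n) d.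
Proof.
move=> ab d0 dn; rewrite -[n - d]mul1n; apply: Ssum_mkseq_ge => // i _.
apply: maw_symdiff_gt0; first by rewrite !size_map !size_iota.
case: d d0 {dn} => //= d _; rewrite eqseq_cons; case: (odd i) => /=.
  by rewrite (negbTE ab).
by rewrite eq_sym (negbTE ab).
Qed.

Section Blocks.
Variables (A : finType) (a : A) (c : nat -> A) (s B : nat).
Hypotheses (B0 : 0 < B) (s0 : 0 < s).
Hypotheses (c_inj : {in gtn s &, injective c}) (c_neq_a : {in gtn s, forall q, c q != a}).

Definition blocks (i : nat) : A := if B %| i then c (i %/ B %% s) else a.

Lemma blocks_multiple q : blocks (q * B) = c (q %% s).
Proof. by rewrite /blocks dvdn_mull // mulnK. Qed.

Lemma blocks_blank m r : (forall j, m <= j < m + r -> ~~ (B %| j)) ->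
  map blocks (iota m r) = nseq r a.
Proof.
move=> H; have /all_pred1P : all (pred1 a) (map blocks (iota m r)).
  apply/allP => _ /mapP[j + ->]; rewrite mem_iota => /H nBj.
  by rewrite /= /blocks (negbTE nBj).
by rewrite size_map size_iota.
Qed.

Lemma eq_mod_small p q : p = q %[mod s] -> p < q + s -> q < p + s -> p = q.
Proof.
wlog le : p q / q <= p => [W|] E lt1 lt2.
  by case: (leqP q p) => [|/ltnW] /W; [apply|move->].
move/eqP: E; rewrite eqn_mod_dvd // => dv.
by case: (posnP (p - q)) => [|lt0]; [lia|rewrite gtnNdvd in dv; lia].
Qed.

(** A letter other than [a] recurs only at distances that are multiples of the period [s * B]. *)
Lemma blocks_inj p q : blocks p = blocks (q * B) ->
  p < q * B + s * B -> q * B < p + s * B -> p = q * B.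
Proof.
rewrite blocks_multiple {1}/blocks; case: ifP => [/dvdnP[p' ->]|_] E; last first.
  by have := c_neq_a (ltn_pmod q s0); rewrite -E eqxx.
rewrite -!mulnDl !ltn_pmul2r // => lt1 lt2; congr (_ * B); apply: eq_mod_small => //.
by move: E; rewrite mulnK // => /c_inj; apply; rewrite inE ltn_pmod.
Qed.

(* With [c_P a^r] the part of the new window that starts at its last letter
   other than [a], the words [c_P a^r c_Q] become MAWs, for the letters [c_Q]
   preceded by [a^r] in the window. *)
Lemma maw_symdiff_blocks d i : d < s * B ->
  (d %/ B).-1 <= maw_symdiff (map blocks (iota i d)) (map blocks (iota i.+1 d)).
Proof.
move=> dsB; set W := map _ _; set W' := map _ _.
have [q [r [eE rB]]] : exists q r, i + d = q * B + r /\ r < B.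
  by exists ((i + d) %/ B), ((i + d) %% B); rewrite -divn_eq ltn_pmod.
(* [v] is the suffix of [W'] that starts at its last multiple of [B]. *)
set v := map blocks (iota (q * B) r.+1).
have BsB : B <= s * B by rewrite leq_pmull.
have dBd := leq_divM d B.
pose w t := rcons v (blocks ((q - t) * B)).
(* Two blocks of slack keep [a^r c_(q-t)] inside [W']: it starts at [i + d - 2 * r - t * B], and
   [r < B]. *)
have tB t : t < (d %/ B).-1 -> (t * B + 2 * B <= d).
  by move=> lt; rewrite -mulnDl (leq_trans _ dBd) // leq_mul2r; lia.
have v_uniq p : i <= p <= i + d -> map blocks (iota p r.+1) = v -> p = q * B.
  by move=> pe [/blocks_inj inj _]; apply: inj; lia.
have v_tail : v = blocks (q * B) :: nseq r a.
  rewrite /v /=; congr (_ :: _); apply: blocks_blank => j jr.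
  apply/negP => /dvdnP[k E]; rewrite E in jr.
  have : q < k by rewrite -(ltn_pmul2r B0); lia.
  have : k < (q).+1 by rewrite -(ltn_pmul2r B0) mulSn; lia.
  by lia.
have w_new t : t < (d %/ B).-1 -> w t \in maw_diff W' W.
  move=> lt; have tBd := tB t lt; have PEt := mulnBl q t B.
  (* The only possible occurrence of [v] ends at position [i + d], just beyond [W]. This shows that
     [w t] is not a MAW of [W], and also that [w t] is absent from [W']. *)
  have vNW p : i <= p -> p + r.+1 <= i + d -> map blocks (iota p r.+1) <> v.
    by move=> ip pe /v_uniq E; have := E; lia.
  rewrite mem_maw_diff /w v_tail rcons_cons !is_maw_cons_rcons -rcons_cons -v_tail.
  have szv : size v = r.+1 by rewrite size_map size_iota.
  apply/andP; split; last first.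
    apply/negP => /and3P[_ /infix_map_iotaP[p [ip pe E]] _].
    by rewrite szv in pe E; apply: vNW (esym E); lia.
  apply/and3P; split.
  - apply/negP => /infix_map_iotaP[p [ip pe E]].
    rewrite size_rcons szv in pe E; move: E.
    rewrite -[r.+2]addn1 iotaD map_cat -[map _ (iota _ 1)]/[:: _] cats1.
    move/rcons_inj/(congr1 fst) => E'.
    by apply: vNW (esym E'); lia.
  - by apply: infix_map_iota; rewrite ?szv; lia.
  have -> : rcons (nseq r a) (blocks ((q - t) * B)) =
      map blocks (iota ((q - t) * B - r) r.+1).
    rewrite -addn1 iotaD map_cat /= cats1 blocks_blank; last first.
      move=> j jr; apply/negP => /dvdnP[k E]; rewrite E in jr.
      have : k < q - t by rewrite -(ltn_pmul2r B0); lia.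
      have : (q - t) < k.+1 by rewrite -(ltn_pmul2r B0) mulSn; lia.
      by lia.
    by congr (rcons _ (blocks _)); lia.
  by apply: infix_map_iota; lia.
rewrite maw_symdiffE; apply: leq_trans (leq_addl _ _).
rewrite -(size_iota 0 (d %/ B).-1) -(size_map w); apply: uniq_leq_size; last first.
  by move=> _ /mapP[t + ->]; rewrite mem_iota => /andP[_]; apply: w_new.
rewrite map_inj_in_uniq ?iota_uniq // => t t'; rewrite !mem_iota !add0n /= => lt lt'.
move/rcons_inj/(congr1 snd)/blocks_inj => E.
have tBd := tB t lt; have tBd' := tB t' lt'.
have PEt := mulnBl q t B; have PEt' := mulnBl q t' B.
have {}E : (q - t) * B = (q - t') * B by apply: E; lia.
have : t * B = t' * B by lia.
by move/eqP; rewrite eqn_pmul2r // => /eqP.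
Qed.

End Blocks.

(** * Choice of parameters and the asymptotic bounds *)

Lemma Ssum_lower (A : finType) d n : 1 < #|A| -> d < n ->
  exists T : seq A, size T = n /\ minn d #|A| * (n - d) <= 10 * Ssum T d.
Proof.
move=> A2 dn; have /card_gt0P[a0 _] : 0 < #|A| by exact: ltnW.
pose c := nth a0 (enum A).
have c_inj i j : i < #|A| -> j < #|A| -> c i = c j -> i = j.
  by move=> iA jA /eqP; rewrite nth_uniq ?enum_uniq -?cardE // => /eqP.
case: (posnP d) => [->|d0]; first by exists (nseq n a0); rewrite size_nseq min0n.
set s := minn d #|A|.-1; case: (ltnP s 4) => s4.
  have c01 : c 0 != c 1 by apply/eqP => /c_inj; lia.
  exists (mkseq (fun i => if odd i then c 0 else c 1) n); rewrite size_mkseq; split=> //.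
  have M10 : minn d #|A| <= 10 by lia.
  exact: leq_mul M10 (Ssum_alternating c01 d0 dn).
(* The least block length with [d < s * B], so that no window contains a full period. *)
pose B := (d %/ s).+1; have s0 : 0 < s by lia.
have dsB : d < s * B by rewrite mulnC ltn_ceil.
(* Since [s <= d], [s * B <= d + s <= 2 * d]. *)
have half : s %/ 2 <= d %/ B.
  rewrite leq_divRL // -(leq_pmul2r (isT : 0 < 2)) mulnAC.
  apply: (leq_trans (leq_mul (leq_divM s 2) (leqnn B))).
  by have := leq_divM d s; rewrite /B mulnS mulnC; lia.
have sub : {in gtn s, forall q, q < #|A|.-1} by move=> q; rewrite inE; lia.
(* The last letter of [A] is the blank; the [s] marks are taken among the others. *)
exists (mkseq (blocks (c #|A|.-1) c s B) n); rewrite size_mkseq; split=> //.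
apply: (@leq_trans (10 * ((d %/ B).-1 * (n - d)))).
  (* For [s >= 4], [minn d #|A| <= s + 1 <= 10 * (s %/ 2 - 1)]. *)
  by rewrite mulnA leq_mul2r; apply/orP; right; lia.
rewrite leq_pmul2l //; apply: Ssum_mkseq_ge => // i _.
apply: maw_symdiff_blocks => // [p q /sub ps /sub qs|q /sub qs].
  by apply: c_inj; lia.
by apply/eqP => /c_inj; lia.
Qed.

Import Order.TTheory GRing.Theory Num.Theory.
Local Open Scope ring_scope.

Theorem theorem4 (R : realType) :
  (exists C : R, 0 < C /\
     forall (A : finType) (d : nat) (T : seq A),
       (2 <= #|A|)%N -> (0 < d)%N -> (d < size T)%N ->
       (Ssum T d)%:R <= C * (minn d #|A|)%:R * (size T)%:R)
  /\
  (forall gamma : R, 0 < gamma < 1 ->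
     exists c : R, 0 < c /\
       forall (A : finType) (d n : nat),
         (2 <= #|A|)%N -> (d < n)%N -> gamma * n%:R <= (n - d)%:R ->
         exists T : seq A, size T = n /\
           c * (minn d #|A|)%:R * n%:R <= (Ssum T d)%:R).
Proof.
split.
  exists 10%:R; split=> [|A d T _ d0 dT]; first by rewrite ltr0n.
  by rewrite -!natrM ler_nat Ssum_upper.
(* [gamma] absorbs the passage from [n - d] to [n], and 10 is the constant of [Ssum_lower]. *)
move=> gamma /andP[g0 _]; exists (gamma / 10%:R).
split=> [|A d n A2 dn gn]; first by rewrite divr_gt0 ?ltr0n.
have [T [szT le]] := Ssum_lower A2 dn; exists T; split=> //.
have ten0 : 0 < 10%:R :> R by rewrite ltr0n.
rewrite -(ler_pM2l ten0) -natrM.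
move: le; rewrite -(ler_nat R); apply: le_trans.
rewrite natrM mulrA mulrA mulrCA mulfV ?gt_eqF // mulr1 mulrAC mulrC.
by rewrite ler_wpM2l // ler0n.
Qed.
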